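(* Let $\mathscr{A}$ and $\mathscr{B}$ be unital $C^*$-algebras. If $\Phi:\mathscr{A}\to\mathscr{B}$ is a (not necessarily linear) Lieb map such that $\Phi(I)>0$, then the following statements hold: (a) $\Phi(|A|^2)\geq\Phi(A)^*\Phi(I)^{-1}\Phi(A)$ for every $A\in\mathscr{A}$. In particular, if $0<\Phi(I)\leq I$, then $\Phi(|A|^2)\geq|\Phi(A)|^2$ for every $A\in\mathscr{A}$. (b) If $\Phi$ is unital, then $\Phi(A^{-1})\geq\Phi(A)^{-1}$ for every $A\in\mathscr{A}_{++}$. Furthermore, if $\Phi:\mathscr{A}\to\mathscr{B}$ is a (not necessarily linear) $2$-positive map between unital $C^*$-algebras with $\Phi(I)>0$, then (a) and (b) are still true.
   Context: Maps between $C^*$-algebras are arbitrary functions; neither linearity nor continuity is assumed. $\mathscr{A}_+$ and $\mathscr{A}_{++}$ denote the sets of positive and of positive invertible elements of $\mathscr{A}$; $A>0$ means $A$ is positive and invertible; $|A|=(A^*A)^{1/2}$. $\Phi$ is unital if $\Phi(I)=I$ (both units are denoted $I$). A map is positive if it sends positive elements to positive elements, and $n$-positive if the entrywise map $\Phi_n:M_n(\mathscr{A})\to M_n(\mathscr{B})$, $\Phi_n([a_{ij}])=[\Phi(a_{ij})]$, is positive. A map $\Phi:\mathscr{A}\to\mathscr{B}$ is called a Lieb map if it satisfies: (Monotonicity) $\Phi(A)\geq\Phi(B)$ whenever $A\geq B$ with $B\in\mathscr{A}_+$; (Cauchy--Schwarz) $\begin{bmatrix}\Phi(A^*A)&\Phi(A^*B)\\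 \Phi(A^*B)^*&\Phi(B^*B)\end{bmatrix}\geq 0$ in $M_2(\mathscr{B})$ for every $A,B\in\mathscr{A}$. The inequality in (b) implicitly includes that $\Phi(A)$ is invertible. *)

(* Defs.v *)
From HB Require Import structures.
From mathcomp Require Import all_boot all_order all_algebra.
From mathcomp Require Import complex.
From mathcomp Require Import all_classical all_reals.

Set Implicit Arguments.
Unset Strict Implicit.
Unset Printing Implicit Defensive.

Import Order.TTheory GRing.Theory Num.Theory.

Local Open Scope ring_scope.

(* Unital C*-algebras, over the complex field R[i] of an arbitrary realType R.  *)
(* The norm is a field of the mixin because HB cannot join the ring and normed  *)
(* module hierarchies below numDomainType, so that no type can inherit both     *)
(* GRing.UnitAlgebra and CompleteNormedModule.  The unit ring structure         *)
(* excludes the zero algebra, and otherwise adds no hypothesis: classically     *)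
(* every nonzero ring has exactly one, with x^-1 = x off the units.             *)
HB.mixin Record isCStarAlgebra (R : realType) A of GRing.UnitAlgebra R[i] A := {
  cnorm : A -> R ;
  cnorm0_eq0 : forall a : A, cnorm a = 0 -> a = 0 ;
  ler_cnormD : forall a b : A, cnorm (a + b) <= cnorm a + cnorm b ;
  cnormZ : forall (c : R[i]) (a : A), cnorm (c *: a) = Normc.normc c * cnorm a ;
  ler_cnormM : forall a b : A, cnorm (a * b) <= cnorm a * cnorm b ;
  cnorm_complete : forall u : nat -> A,
    (forall e : R, 0 < e -> exists N : nat, forall m n : nat,
       (N <= m)%N -> (N <= n)%N -> cnorm (u m - u n) < e) ->
    exists l : A, forall e : R, 0 < e -> exists N : nat, forall n : nat,
       (N <= n)%N -> cnorm (u n - l) < e ;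
  star : A -> A ;
  starK : involutive star ;
  starD : {morph star : a b / a + b} ;
  starZ : forall (c : R[i]) (a : A), star (c *: a) = conjc c *: star a ;
  starM : forall a b : A, star (a * b) = star b * star a ;
  cnorm_starM : forall a : A, cnorm (star a * a) = cnorm a ^+ 2
}.

#[short(type="cstarAlgType")]
HB.structure Definition CStarAlgebra (R : realType) :=
  {A of GRing.UnitAlgebra R[i] A & isCStarAlgebra R A}.

Section CStarAlgebra_order.
Variables (R : realType) (A : cstarAlgType R).
Implicit Types a b p : A.

Definition positive a : Prop := exists b, a = star b * b.

(* the Loewner order: cle a b is a <= b *)
Definition cle a b : Prop := positive (b - a).

(* a > 0, i.e. a is positive and invertible *)
Definition strictly_positive a : Prop := positive a /\ a \is a GRing.unit.

(* The positive square root; 0 is a dummy value when there is none. *)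
Definition csqrt a : A := xget 0 [set p | positive p /\ p ^+ 2 = a].

Definition cabs a : A := csqrt (star a * a).

Definition mxstar n (M : 'M[A]_n) : 'M[A]_n := (map_mx star M)^T.

(* Positivity in the C*-algebra M_n(A); like positive, it depends only on the  *)
(* *-algebra structure, so that the C*-norm of M_n(A) need not be mentioned.   *)
Definition mxpositive n (M : 'M[A]_n) : Prop :=
  exists N : 'M[A]_n, M = mxstar N *m N.

Definition mx2 (a11 a12 a21 a22 : A) : 'M[A]_2 :=
  @block_mx A 1 1 1 1 a11%:M a12%:M a21%:M a22%:M.

End CStarAlgebra_order.

Section Maps.
Variables (R : realType) (A B : cstarAlgType R).
Implicit Type Phi : A -> B.

Definition lieb_monotone Phi : Prop :=
  forall a b : A, positive b -> cle b a -> cle (Phi b) (Phi a).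

Definition lieb_cauchy_schwarz Phi : Prop :=
  forall a b : A,
    mxpositive (mx2 (Phi (star a * a))        (Phi (star a * b))
                    (star (Phi (star a * b))) (Phi (star b * b))).

Definition lieb_map Phi : Prop := lieb_monotone Phi /\ lieb_cauchy_schwarz Phi.

Definition n_positive n Phi : Prop :=
  forall M : 'M[A]_n, mxpositive M -> mxpositive (map_mx Phi M).

End Maps.

(* Main.v *)
Require Import Defs.
From HB Require Import structures.
From mathcomp Require Import all_boot all_order all_algebra.
From mathcomp Require Import complex.
From mathcomp Require Import all_classical all_reals.
From mathcomp Require Import ring lra.

(** The heart of the matter is a Schur complement.  If the matrix with rows
    (p, q) and (star q, s) has the form star N * N and p is invertible, then
    evaluating its quadratic form at the column (- p^-1 q, 1) leaves
    s - star q p^-1 q, which is therefore positive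
    ([schur_complement_positive]).  Applied to the Cauchy-Schwarz matrix of Phi
    at (1, a) this is the first inequality of (a); the second one follows
    because Phi 1 <= 1 gives (Phi 1)^-1 >= 1.  For (b), write a = star b * b;
    the Cauchy-Schwarz matrix at (b, b a^-1) has diagonal Phi a, Phi a^-1 and
    off-diagonal entries Phi 1 = 1.  Its quadratic form at (1, - t) bounds Phi a
    below by a positive real for small t, so that Phi a is invertible
    ([unit_of_mxpositive_offdiag1]), and the Schur complement is then the
    claimed inequality.  A 2-positive map satisfies Cauchy-Schwarz
    because the Gram matrix of (a, b) is positive.

    Positive elements being those of the form star b * b, the order-theoretic
    facts used above rest on three theorems about C*-algebras: positive elements
    have positive square roots, their sums are positive, and an element bounded
    below by a positive real is invertible.  They are proved without spectral
    theory, through squares p * p of self-adjoint elements p.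

    - If x is self-adjoint of norm at most 1, then 1 - x is a square
      ([sqrt_one_sub]): 1 - z is a root when z = (x + z * z) / 2, and iterating
      this equation from 0 converges since it is majorized by the same iteration
      on real numbers with x replaced by 1.
    - Hence, for self-adjoint a, having |t - a| <= t for some real t >= 0 is
      equivalent to being a square ([hermitian_squareP]).  Conversely, if p is
      self-adjoint of norm at most 1, then p is the real part of the unitary
      p + i sqrt(1 - p * p), whose imaginary part is at most 1 in norm.  The
      norm condition is obviously stable under addition.
    - Every a = star b * b is a square ([star_mul_hermitian_square]).  With
      y = |a| and d = y - a, which is twice the negative part of a, the element
      c = b d satisfies star c * c = - (d y d), the opposite of a square.  This
      forces c = 0 ([star_mul_neg_square_eq0]) and then d = 0, so that a = |a|.
*)

Set Implicit Arguments.
Unset Strict Implicit.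
Unset Printing Implicit Defensive.

Import Order.TTheory GRing.Theory Num.Theory.

Local Open Scope ring_scope.

(** * Norm and involution *)

Section Norm.
Local Open Scope complex_scope.
Local Open Scope ring_scope.
Variables (R : realType) (A : cstarAlgType R).
Implicit Types (a b l x y : A) (u v : nat -> A) (r e : R).

Lemma normc_real r : Normc.normc r%:C = `|r|.
Proof. by rewrite /Normc.normc /= expr0n /= addr0 sqrtr_sqr. Qed.

Lemma cnormZr r a : cnorm (r%:C *: a) = `|r| * cnorm a.
Proof. by rewrite cnormZ normc_real. Qed.

Lemma cnormN a : cnorm (- a) = cnorm a.
Proof. by rewrite -scaleN1r -(rmorphN1 (real_complex R)) cnormZr normrN1 mul1r. Qed.

Lemma cnorm0 : cnorm (0 : A) = 0.
Proof. by rewrite -(scale0r 0) -(rmorph0 (real_complex R)) cnormZr normr0 mul0r. Qed.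

Lemma cnorm_ge0 a : 0 <= cnorm a.
Proof. by have := ler_cnormD a (- a); rewrite subrr cnorm0 cnormN; lra. Qed.

Lemma ler_cnormB a b : cnorm (a - b) <= cnorm a + cnorm b.
Proof. by rewrite -(cnormN b) ler_cnormD. Qed.

Lemma cnorm_distC a b : cnorm (a - b) = cnorm (b - a).
Proof. by rewrite -cnormN opprB. Qed.

Lemma ler_cnorm_dist l a b : cnorm (a - b) <= cnorm (a - l) + cnorm (b - l).
Proof.
by rewrite (cnorm_distC b l) -(subrKA l a (- b)) ler_cnormD.
Qed.

Lemma star0 : star (0 : A) = 0.
Proof. by apply: (addrI (star 0)); rewrite -starD !addr0. Qed.

Lemma starN a : star (- a) = - star a.
Proof. by apply: (addrI (star a)); rewrite -starD !subrr star0. Qed.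

Lemma starB a b : star (a - b) = star a - star b.
Proof. by rewrite starD starN. Qed.

Lemma star1 : star (1 : A) = 1.
Proof. by rewrite -[RHS]starK -[star 1 in RHS]mul1r starM starK mul1r. Qed.

Lemma starZr r a : star (r%:C *: a) = r%:C *: star a.
Proof. by rewrite starZ conjc_real. Qed.

Lemma cnorm_star a : cnorm (star a) = cnorm a.
Proof.
suff le b : cnorm b <= cnorm (star b).
  by apply/eqP; rewrite eq_le le -{2}(starK a) le.
have [-> | nz] := eqVneq (cnorm b) 0; first exact: cnorm_ge0.
have b0 : 0 < cnorm b by rewrite lt_def nz cnorm_ge0.
by rewrite -(ler_pM2r b0) -expr2 -cnorm_starM ler_cnormM.
Qed.

Lemma cnorm_eq0 a : (cnorm a == 0) = (a == 0).
Proof. by apply/eqP/eqP => [/cnorm0_eq0 | ->] //; rewrite cnorm0. Qed.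

Lemma cnorm1 : cnorm (1 : A) = 1.
Proof.
have nz : cnorm (1 : A) != 0 by rewrite cnorm_eq0 oner_eq0.
by apply: (mulfI nz); rewrite -expr2 -cnorm_starM star1 !mulr1.
Qed.

Lemma cnorm_real r : cnorm (r%:C *: (1 : A)) = `|r|.
Proof. by rewrite cnormZr cnorm1 mulr1. Qed.

Lemma cnorm_sqr_sa a : star a = a -> cnorm (a * a) = cnorm a ^+ 2.
Proof. by move=> sa; rewrite -{1}sa cnorm_starM. Qed.

(** * Limits of sequences *)

Definition cnorm_lim u l : Prop :=
  forall e, 0 < e -> exists N : nat, forall n : nat, (N <= n)%N ->
    cnorm (u n - l) < e.

Lemma cnorm_le_eps_eq0 a K : (forall e, 0 < e -> cnorm a <= K * e) -> a = 0.
Proof.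
move=> small; apply: cnorm0_eq0; apply/eqP; rewrite eq_le cnorm_ge0 andbT.
have K1 : 0 < `|K| + 1 by rewrite ltr_wpDl.
rewrite leNgt; apply/negP => a0.
have := small (cnorm a / 2 / (`|K| + 1)); rewrite !divr_gt0 // => /(_ isT).
rewrite mulrA ler_pdivlMr // => le; have := ler_norm K; nra.
Qed.

Lemma cnorm_lim_unique u l l' : cnorm_lim u l -> cnorm_lim u l' -> l = l'.
Proof.
move=> ul ul'; apply/eqP; rewrite -subr_eq0; apply/eqP.
apply: (@cnorm_le_eps_eq0 _ 2) => e e0.
have [N lN] := ul _ e0; have [N' lN'] := ul' _ e0.
have := lN _ (leq_maxl N N'); have := lN' _ (leq_maxr N N').
have := ler_cnorm_dist (u (maxn N N')) l l'.
by rewrite !(cnorm_distC _ (u _)); lra.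
Qed.

Lemma cnorm_lim_lipschitz u l (F : A -> A) K :
    (forall n, cnorm (F (u n) - F l) <= K * cnorm (u n - l)) ->
  cnorm_lim u l -> cnorm_lim (F \o u) (F l).
Proof.
move=> lipF ul e e0; have K1 : 0 < `|K| + 1 by rewrite ltr_wpDl.
have [N lN] := ul (e / (`|K| + 1)) (divr_gt0 e0 K1).
exists N => n /lN; rewrite ltr_pdivlMr // => lt; apply: le_lt_trans (lipF n) _.
have := cnorm_ge0 (u n - l); have := ler_norm K; nra.
Qed.

Lemma cnorm_lim_norm_le u l K :
  (forall n, cnorm (u n) <= K) -> cnorm_lim u l -> cnorm l <= K.
Proof.
move=> uK ul; rewrite leNgt; apply/negP => lK.
have [|N /(_ N (leqnn N)) lN] := ul (cnorm l - K); first by rewrite subr_gt0.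
have := ler_cnormB (u N) (u N - l); rewrite subKr.
by have := uK N; lra.
Qed.

Lemma cnorm_lim_mull u l y : cnorm_lim u l -> cnorm_lim (fun n => y * u n) (y * l).
Proof.
apply: (cnorm_lim_lipschitz (F := fun a => y * a) (K := cnorm y)) => n.
by rewrite -mulrBr ler_cnormM.
Qed.

Lemma cnorm_lim_mulr u l y : cnorm_lim u l -> cnorm_lim (fun n => u n * y) (l * y).
Proof.
apply: (cnorm_lim_lipschitz (F := fun a => a * y) (K := cnorm y)) => n.
by rewrite -mulrBl mulrC ler_cnormM.
Qed.

Lemma cnorm_lim_star u l : cnorm_lim u l -> cnorm_lim (fun n => star (u n)) (star l).
Proof.
apply: (cnorm_lim_lipschitz (F := star) (K := 1)) => n.
by rewrite -starB cnorm_star mul1r.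
Qed.

(** The majorant principle: the steps of [u] are dominated by those of a
    nondecreasing bounded, hence Cauchy, real sequence. *)
Lemma majorized_converges u (zeta : nat -> R) K :
    (forall n, cnorm (u n.+1 - u n) <= zeta n.+1 - zeta n) ->
    (forall n, zeta n <= K) ->
  exists l, cnorm_lim u l.
Proof.
move=> uzeta zetaK.
have dist N k : cnorm (u (N + k)%N - u N) <= zeta (N + k)%N - zeta N.
  elim: k => [|k IHk]; first by rewrite addn0 !subrr cnorm0.
  have := ler_cnormD (u (N + k.+1)%N - u (N + k)%N) (u (N + k)%N - u N).
  by rewrite subrKA addnS; have := uzeta (N + k)%N; lra.
apply: cnorm_complete => e e0; pose E := range zeta.
have supE : has_sup E.
  split; first by exists (zeta 0%N), 0%N.
  by exists K => _ [n _ <-].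
have [|_ [N _ <-] supN] := @sup_adherent R E (e / 2) _ supE; first by lra.
have close n : (N <= n)%N -> cnorm (u n - u N) < e / 2.
  move=> /subnKC <-; apply: le_lt_trans (dist _ _) _.
  have : zeta (N + (n - N))%N <= sup E.
    by apply: sup_ubound; [case: supE | exists (N + (n - N))%N].
  lra.
exists N => m n /close lm /close ln.
by have := ler_cnorm_dist (u N) (u m) (u n); lra.
Qed.

(** The form in which the majorant principle is used twice: for the square root
    of [1 - x] and for the inverse of [1 - x].  The limit itself is kept in the
    conclusion because self-adjointness and commutation relations pass from the
    iterates to the fixed point. *)
Lemma majorized_fixpoint (F : A -> A) (zeta : nat -> R) (K C : R) :
    let u n := iter n F 0 in
    zeta 0%N = 0 ->
    (forall n, cnorm (u n.+1 - u n) <= zeta n.+1 - zeta n) ->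
    (forall n, zeta n <= K) ->
    (forall a b, cnorm a <= K -> cnorm b <= K ->
       cnorm (F a - F b) <= C * cnorm (a - b)) ->
  exists l, [/\ cnorm_lim u l, F l = l & cnorm l <= K].
Proof.
move=> u zeta0 uzeta zetaK lipF.
have [l ul] := majorized_converges uzeta zetaK; exists l.
have uK n : cnorm (u n) <= K.
  apply: le_trans (zetaK n); elim: n => [|n]; first by rewrite cnorm0 zeta0.
  have := ler_cnormD (u n.+1 - u n) (u n); rewrite subrK.
  by have := uzeta n; lra.
have lK := cnorm_lim_norm_le uK ul; split=> //.
apply: (@cnorm_lim_unique (F \o u)); last first.
  by move=> e /ul[N lN]; exists N => n Nn; apply: (lN n.+1); apply: leqW.
by apply: (@cnorm_lim_lipschitz _ _ _ C) ul => n; apply: lipF.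
Qed.

End Norm.

(** * Squares of self-adjoint elements *)

Section SquareRoots.
Local Open Scope complex_scope.
Local Open Scope ring_scope.
Variables (R : realType) (A : cstarAlgType R).
Implicit Types (a b c p q v w x y z : A) (t r : R).

Lemma cnorm_subr_mul_self a b :
  cnorm (a * a - b * b) <= (cnorm a + cnorm b) * cnorm (a - b).
Proof.
have -> : a * a - b * b = a * (a - b) + (a - b) * b.
  by rewrite mulrBr mulrBl subrKA.
apply: le_trans (ler_cnormD _ _) _.
by rewrite (mulrDl (cnorm a)) (mulrC (cnorm b)) lerD ?ler_cnormM.
Qed.

(** The root is [1 - z] with [z] the fixed point of [(x + z * z) / 2]; the
    iterates are polynomials in [x], hence the commutation property.  The
    bound on [1 - y] makes [y] itself amenable to a further root extraction. *)
Lemma sqrt_one_sub x : star x = x -> cnorm x <= 1 ->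
  exists y, [/\ star y = y, y * y = 1 - x, cnorm (1 - y) <= 1
    & forall v, GRing.comm v x -> GRing.comm v y].
Proof.
move=> sx x1; pose F a := (2^-1 : R)%:C *: (x + a * a).
pose zeta n := iter n (fun s : R => (1 + s * s) / 2) 0.
have zeta01 n : 0 <= zeta n <= 1.
  by elim: n => [|n /andP[? ?]]; rewrite /= ?lexx ?ler01 //; apply/andP; split; nra.
have normF a b : cnorm (F a - F b) <= (cnorm a + cnorm b) / 2 * cnorm (a - b).
  rewrite -scalerBr cnormZr opprD addrACA subrr add0r ger0_norm ?invr_ge0 //.
  by have := cnorm_subr_mul_self a b; nra.
pose u n := iter n F 0.
have u_zeta n : cnorm (u n) <= zeta n.
  elim: n => [|n IHn]; first by rewrite cnorm0.
  rewrite /= cnormZr ger0_norm ?invr_ge0 //.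
  have := ler_cnormD x (u n * u n); have := ler_cnormM (u n) (u n).
  by have := cnorm_ge0 (u n); nra.
have [n | | | l [ul Fl l1]] := @majorized_fixpoint R A F zeta 1 1 (erefl _).
- elim: n => [|n IHn].
    rewrite /= subr0 mulr0 addr0 cnormZr ger0_norm ?invr_ge0 //.
    by rewrite mul0r addr0 subr0 mulrC ler_pM2r ?invr_gt0.
  apply: le_trans (normF _ _) _; have := u_zeta n; have := u_zeta n.+1.
  have := cnorm_ge0 (u n); have := cnorm_ge0 (u n.+1).
  have := cnorm_ge0 (u n.+1 - u n); move: IHn; rewrite -/(u n.+1) -/(u n).
  rewrite [zeta n.+2]/= -/(zeta n.+1).
  move=> ? ? ? ? ? ?.
  (* the scalar iteration satisfies the difference bound with equality *)
  have -> : (1 + zeta n.+1 * zeta n.+1) / 2 - zeta n.+1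
    = (zeta n.+1 + zeta n) / 2 * (zeta n.+1 - zeta n) by rewrite /=; field.
  by apply: ler_pM => //; lra.
- by move=> n; case/andP: (zeta01 n).
- move=> a b a1 b1; apply: le_trans (normF a b) _.
  by apply: ler_wpM2r; [exact: cnorm_ge0 | lra].
have lE : l + l = x + l * l.
  by rewrite -{1 2}Fl /F -scalerDl -rmorphD [_ + _](_ : _ = 1) ?scale1r //; lra.
exists (1 - l); split.
- rewrite starB star1; congr (_ - _); apply: (cnorm_lim_unique _ ul).
  have := cnorm_lim_star ul; congr cnorm_lim; apply/funext; elim=> [|n IHn].
    by rewrite star0.
  by rewrite /= /F starZr starD starM sx IHn.
- have llE : l * l = l + l - x by rewrite lE addrC addKr.
  by rewrite mulrBl mul1r mulrBr mulr1 opprB llE -(addrA l) (addrAC l) subrr add0r subrKA.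
- by rewrite subKr.
- move=> v vx; apply: commrB; first exact: commr1.
  apply: (cnorm_lim_unique (cnorm_lim_mull v ul)).
  have := cnorm_lim_mulr v ul; congr cnorm_lim; apply/funext.
  suff uv n : GRing.comm v (u n) by move=> n; rewrite uv.
  elim: n => [|n IHn]; first exact: commr0.
  rewrite /GRing.comm /= /F -scalerAl -scalerAr; congr (_ *: _).
  by apply: commrD => //; apply: commrM.
Qed.

(** The preceding lemma for [a = t * (1 - x)]; the conclusion again has the shape
    of the hypothesis, so that roots can be iterated. *)
Lemma sqrt_of_norm t a : star a = a -> 0 <= t -> cnorm (t%:C *: 1 - a) <= t ->
  exists y, [/\ star y = y, y * y = a,
    cnorm ((Num.sqrt t)%:C *: 1 - y) <= Num.sqrt t
    & forall v, GRing.comm v a -> GRing.comm v y].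
Proof.
move=> sa; rewrite le_eqVlt => /predU1P[<- | t0 ta].
  rewrite scale0r sub0r cnormN => a0.
  have -> : a = 0 by apply: cnorm0_eq0; apply/eqP; rewrite eq_le a0 cnorm_ge0.
  exists 0; split; rewrite ?star0 ?mulr0 //.
    by rewrite sqrtr0 scale0r subr0 cnorm0.
have tC : t%:C != 0 by rewrite (fmorph_eq0 (real_complex R)) gt_eqF.
have [|| y [sy yE y1 yC]] := @sqrt_one_sub (1 - (t^-1)%:C *: a).
- by rewrite starB star1 starZr sa.
- have -> : 1 - (t^-1)%:C *: a = (t^-1)%:C *: (t%:C *: 1 - a).
    by rewrite scalerBr scalerA -rmorphM mulVf ?gt_eqF // scale1r.
  by rewrite cnormZr gtr0_norm ?invr_gt0 // mulrC ler_pdivrMr // mul1r.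
exists ((Num.sqrt t)%:C *: y); split.
- by rewrite starZr sy.
- rewrite -scalerAl -scalerAr scalerA -rmorphM -expr2 sqr_sqrtr ?ltW //.
  by rewrite yE subKr scalerA -rmorphM mulfV ?gt_eqF // scale1r.
- rewrite -scalerBr cnormZr ger0_norm ?sqrtr_ge0 //.
  by have := sqrtr_ge0 t; nra.
- move=> v va; rewrite /GRing.comm -scalerAl -scalerAr; congr (_ *: _).
  apply: yC; apply: commrB; first exact: commr1.
  by rewrite /GRing.comm -scalerAl -scalerAr va.
Qed.

(** For [r >= 0] this says that the real part [q] of a multiple [z = q + i w] of a
    unitary is at most [z] in norm, since [star z * z = r].  The absolute
    value is the norm of the scalar [r]. *)
Lemma norm_le_of_sum_squares q w r : star q = q -> star w = w ->
  GRing.comm q w -> q * q + w * w = r%:C *: 1 -> cnorm q ^+ 2 <= `|r|.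
Proof.
move=> sq sw qw sumE; pose z := q + 'i *: w.
have sz : star z = q - 'i *: w.
  by rewrite starD starZ sq sw -scaleNr; congr (_ + _ *: _); rewrite /= ; simpc.
have z2 : cnorm z ^+ 2 = `|r|.
  rewrite -cnorm_starM sz -(cnorm_real A) -sumE; congr cnorm.
  rewrite /z mulrBl mulrDr mulrDr -scalerAl -!scalerAr -scalerAl scalerA.
  have -> : 'i * 'i = -1 :> R[i] by rewrite -expr2 sqr_i.
  by rewrite scaleN1r qw opprD opprK addrA addrK.
have := ler_cnormD z (star z).
rewrite cnorm_star {1}/z sz addrACA subrr addr0.
have -> : q + q = (2 : R)%:C *: q by rewrite rmorphD scalerDl scale1r.
rewrite cnormZr ger0_norm // -z2.
by have := cnorm_ge0 q; have := cnorm_ge0 z; nra.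
Qed.

(** With [w * w = t - p * p], the elements [p] and [w] are the real and imaginary
    parts of a multiple of a unitary, which bounds [w]. *)
Lemma square_norm t p : star p = p -> cnorm (p * p) <= t ->
  cnorm (t%:C *: 1 - p * p) <= t.
Proof.
move=> sp pt; have t0 : 0 <= t := le_trans (cnorm_ge0 _) pt.
have [||| w [sw wE _ wC]] := @sqrt_of_norm t (t%:C *: 1 - p * p) => //.
- by rewrite starB starZr star1 starM sp.
- by rewrite subKr.
rewrite -wE cnorm_sqr_sa // -[leRHS]ger0_norm //.
apply: (norm_le_of_sum_squares (w := p)) => //; last by rewrite wE subrK.
apply/commr_sym/wC/commrB; last exact: commrM.
by rewrite /GRing.comm -scalerAr -scalerAl mulr1 mul1r.
Qed.

(** This turns out to be the same as [positive], but unlike for [positive] the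
    stability under addition can be reached directly. *)
Definition hermitian_square a : Prop := exists p, star p = p /\ a = p * p.

Lemma hermitian_squareP a : hermitian_square a <->
  star a = a /\ exists2 t, 0 <= t & cnorm (t%:C *: 1 - a) <= t.
Proof.
split=> [[p [sp ->]] | [sa [t t0 ta]]].
  rewrite starM sp; split=> //; exists (cnorm (p * p)); first exact: cnorm_ge0.
  exact: square_norm.
by have [y [sy <- _ _]] := sqrt_of_norm sa t0 ta; exists y.
Qed.

Lemma hermitian_squareD a b :
  hermitian_square a -> hermitian_square b -> hermitian_square (a + b).
Proof.
move=> /hermitian_squareP[sa [t t0 ta]] /hermitian_squareP[sb [s s0 sb']].
apply/hermitian_squareP; split; first by rewrite starD sa sb.
exists (t + s); first exact: addr_ge0.
rewrite rmorphD scalerDl opprD addrACA.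
by apply: le_trans (ler_cnormD _ _) _; apply: lerD.
Qed.

Lemma hermitian_squareZ r a : 0 <= r ->
  hermitian_square a -> hermitian_square (r%:C *: a).
Proof.
move=> r0 [p [sp ->]]; exists ((Num.sqrt r)%:C *: p); split; first by rewrite starZr sp.
by rewrite -scalerAl -scalerAr scalerA -rmorphM -(expr2 (Num.sqrt r)) sqr_sqrtr.
Qed.

Lemma sqrt_real_sub t a : star a = a -> cnorm a <= t ->
  exists w, [/\ star w = w, w * w = t%:C *: 1 - a
    & forall v, GRing.comm v a -> GRing.comm v w].
Proof.
move=> sa at_; have t0 : 0 <= t := le_trans (cnorm_ge0 _) at_.
have [||| w [sw wE _ wC]] := @sqrt_of_norm t (t%:C *: 1 - a) => //.
- by rewrite starB starZr star1 sa.
- by rewrite subKr.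
exists w; split=> // v va; apply/wC/commrB => //.
by rewrite /GRing.comm -scalerAr -scalerAl mulr1 mul1r.
Qed.

End SquareRoots.

(** * Elements of the form star b * b are squares *)

Section StarSquares.
Local Open Scope complex_scope.
Local Open Scope ring_scope.
Variables (R : realType) (A : cstarAlgType R).
Implicit Types (a b c p q v w x y z : A) (t r : R).

Lemma sqrD_subr_sqrB a b :
  (a + b) * (a + b) - (a - b) * (a - b) = (a * b + b * a) + (a * b + b * a).
Proof.
rewrite [X in X - _]mulrDr [X in _ - X]mulrBr opprD opprK addrACA -mulrBl -mulrDl.
rewrite opprD opprK addrACA subrr add0r addrACA subrr addr0.
by rewrite !mulrDl addrC -addrACA.
Qed.

(** Writing [H] and [K] for twice the real part and, up to sign, twice the
    imaginary part of [c], one has [H * H + K * K = 2 (c * star c + star c * c)],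
    so that [c * star c] is a combination of squares. *)
Lemma hermitian_square_mul_star c :
  hermitian_square (- (star c * c)) -> hermitian_square (c * star c).
Proof.
move=> neg; pose H := c + star c; pose K := 'i *: (c - star c).
have sH : star H = H by rewrite starD starK addrC.
have sK : star K = K.
  rewrite /K starZ starB starK -(opprB c) scalerN -scaleNr.
  by congr (_ *: _); simpc.
have KK : K * K = - ((c - star c) * (c - star c)).
  rewrite -scalerAl -scalerAr scalerA.
  have -> : 'i * 'i = -1 :> R[i] by rewrite -expr2 sqr_i.
  by rewrite scaleN1r.
have two : (2 : R)%:C *: (c * star c) = (H * H + K * K) + (- (star c * c) - star c * c).
  rewrite KK sqrD_subr_sqrB addrACA !addrK.
  by rewrite rmorphD scalerDl scale1r.
have -> : c * star c = (2^-1)%:C *: ((2 : R)%:C *: (c * star c)).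
  by rewrite scalerA -rmorphM mulVf ?pnatr_eq0 // scale1r.
apply: hermitian_squareZ; rewrite ?invr_ge0 // two.
apply: hermitian_squareD; last exact: hermitian_squareD.
by apply: hermitian_squareD; [exists H | exists K].
Qed.

(** The usual proof compares the spectra of [star c * c] and [c * star c].  Here a
    norm estimate does the same.  Let [star c * c = - (q * q)] and [T = |c|^2],
    which is also the norm of [q * q].  As [c * star c] is a square of norm at most
    [T], the element [T - c * star c] has norm at most [T]; multiplying it by
    [star c] and [c] shows that [T (q * q) + q * q * (q * q)] has norm at most
    [T^2], whereas functional calculus would give it norm [2 T^2].  Completing the
    square turns this into a bound on [q * q + T / 2] strictly below [3 T / 2],
    whence [|q * q| < T] unless [T = 0]. *)
Lemma star_mul_neg_square_eq0 c :
  hermitian_square (- (star c * c)) -> c = 0.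
Proof.
move=> neg; have [p [sp pE]] := hermitian_square_mul_star neg.
case: neg => q [sq qE].
have cE : star c * c = - (q * q) by rewrite -qE opprK.
pose T := cnorm c ^+ 2.
have T0 : 0 <= T by exact: sqr_ge0.
have qT : cnorm q ^+ 2 = T by rewrite -cnorm_sqr_sa // -cnormN -cE cnorm_starM.
have pT : cnorm (T%:C *: 1 - c * star c) <= T.
  rewrite pE; apply: square_norm => //; rewrite -pE.
  by rewrite -{1}(starK c) cnorm_starM cnorm_star.
have dE : star c * (T%:C *: 1 - c * star c) * c =
    - (T%:C *: (q * q) + q * q * (q * q)).
  rewrite mulrBr mulrBl -scalerAr mulr1 -scalerAl.
  rewrite (mulrA (star c) c) -(mulrA (star c * c)) cE.
  by rewrite mulrNN scalerN opprD.
have dT : cnorm (T%:C *: (q * q) + q * q * (q * q)) <= T * T.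
  rewrite -cnormN -dE; apply: le_trans (ler_cnormM _ _) _.
  have := ler_cnormM (star c) (T%:C *: 1 - c * star c); rewrite cnorm_star.
  have := cnorm_ge0 c; have := cnorm_ge0 (T%:C *: 1 - c * star c).
  by move: pT; rewrite /T; nra.
pose x := q * q + (T / 2)%:C *: 1.
have sx : star x = x by rewrite starD starM sq starZr star1.
have xx : x * x = (T%:C *: (q * q) + q * q * (q * q)) + (T * T / 4)%:C *: 1.
  rewrite mulrDl !mulrDr -!scalerAl -!scalerAr mulr1 !mul1r scalerA -rmorphM.
  rewrite addrA -(addrA (q * q * _)) -scalerDl -rmorphD [q * q * _ + _]addrC.
  by congr (_%:C *: _ + _ + _%:C *: _); field.
(* the square root of 5 / 4 would be the sharp constant; 5 / 4 is below 3 / 2 *)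
have xT : cnorm x <= 5 / 4 * T.
  have : cnorm x ^+ 2 <= T * T + T * T / 4.
    rewrite -cnorm_sqr_sa // xx; apply: le_trans (ler_cnormD _ _) _.
    by rewrite cnorm_real [`|_|]ger0_norm ?lerD2r // divr_ge0 // mulr_ge0.
  by have := cnorm_ge0 x; nra.
have [w [sw wE wC]] := sqrt_real_sub sx xT.
have qw : GRing.comm q w.
  apply: wC; apply: commrD; first exact: commrM.
  by rewrite /GRing.comm -scalerAr -scalerAl mulr1 mul1r.
have := @norm_le_of_sum_squares _ _ q w (3 / 4 * T) sq sw qw.
rewrite wE /x opprD addrCA addNKr.
rewrite -scalerBl -rmorphB => /(_ _); rewrite qT ger0_norm => [le|]; last by lra.
apply: cnorm0_eq0; apply/eqP; rewrite -sqrf_eq0 eq_le sqr_ge0 andbT -/T.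
have : T <= 3 / 4 * T by apply: le; congr (_%:C *: _); field.
lra.
Qed.

(** Two successive root extractions: [w * w] is the positive square root of [a]. *)
Lemma hermitian_square_fourth_power a : hermitian_square a ->
  exists w, [/\ star w = w, w * w * (w * w) = a
    & forall v, GRing.comm v a -> GRing.comm v w].
Proof.
case=> p [sp ->].
have [|||y [sy yE y1 yC]] := @sqrt_of_norm _ _ (cnorm (p * p)) (p * p).
- by rewrite starM sp.
- exact: cnorm_ge0.
- exact: square_norm.
have [w [sw wE _ wC]] := sqrt_of_norm sy (sqrtr_ge0 _) y1.
by exists w; split=> [//||v /yC/wC //]; rewrite wE.
Qed.

(** [y] is the absolute value of [a], and [d = y - a] is twice the negative part of
    [a].  From [y * y = a * a] comes [a d = - (y d)], so that [b d] falls under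
    [star_mul_neg_square_eq0], which gives [d a d = d y d = 0] and [d * d * d = 0]. *)
Lemma star_mul_hermitian_square b : hermitian_square (star b * b).
Proof.
set a := star b * b.
have sa : star a = a by rewrite starM starK.
have [|w [sw wE wC]] := @hermitian_square_fourth_power (a * a); first by exists a.
have aw : GRing.comm a w by apply: wC; apply: commrM.
pose y := w * w; pose d := y - a.
have sy : star y = y by rewrite starM sw.
have sd : star d = d by rewrite starB sy sa.
have wd : GRing.comm w d.
  by apply: commrB; [exact: commrM | exact: commr_sym].
have ya : y * a = a * y by rewrite /y -mulrA -aw mulrA -aw mulrA.
have ad : a * d = - (y * d).
  by rewrite /d !mulrBr -wE opprB ya.
have dad : d * a * d = - (d * y * d) by rewrite -mulrA ad mulrN mulrA.
have dyd : d * y * d = (d * w) * (d * w).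
  by rewrite /y -!mulrA wd.
have bd0 : b * d = 0.
  apply: star_mul_neg_square_eq0; rewrite starM sd mulrA -(mulrA d).
  rewrite -/a dad opprK dyd; exists (d * w); split=> //.
  by rewrite starM sw sd wd.
have dad0 : d * a * d = 0 by rewrite /a mulrA -(mulrA _ b) bd0 mulr0.
have d3 : d * d * d = 0.
  have -> : d * d * d = d * y * d - d * a * d by rewrite -mulrBl -mulrBr.
  by rewrite dad0 subr0 -[LHS]opprK -dad dad0 oppr0.
have d0 : d = 0.
  apply: cnorm0_eq0; apply/eqP; rewrite -sqrf_eq0 -cnorm_sqr_sa //.
  rewrite -sqrf_eq0 -cnorm_sqr_sa ?starM ?sd //.
  by rewrite mulrA d3 mul0r cnorm0.
by exists w; split=> //; apply/eqP; rewrite eq_sym -subr_eq0 -/d d0.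
Qed.
End StarSquares.

(** * Positive elements *)

Section Positive.
Local Open Scope complex_scope.
Local Open Scope ring_scope.
Variables (R : realType) (A : cstarAlgType R).
Implicit Types (a b m n p q s x y : A) (t r : R).

Lemma positiveP a : positive a <-> hermitian_square a.
Proof.
split=> [[b ->] | [p [sp ->]]]; first exact: star_mul_hermitian_square.
by exists p; rewrite sp.
Qed.

Lemma positive_sa a : positive a -> star a = a.
Proof. by case=> b ->; rewrite starM starK. Qed.

Lemma positiveD a b : positive a -> positive b -> positive (a + b).
Proof. by rewrite !positiveP; apply: hermitian_squareD. Qed.

Lemma positive_congr a x : positive a -> positive (star x * a * x).
Proof. by case=> b ->; exists (b * x); rewrite starM !mulrA. Qed.

Lemma cabs_sqr a : cabs a ^+ 2 = star a * a.
Proof.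
have [w [sw wE _]] := hermitian_square_fourth_power (star_mul_hermitian_square a).
suff [_ ->] : positive (cabs a) /\ cabs a ^+ 2 = star a * a by [].
rewrite /cabs /csqrt; apply: (@xgetPex _ 0 [set p | positive p /\ p ^+ 2 = star a * a]).
by exists (w * w); split; [exists w; rewrite sw | rewrite expr2].
Qed.

Lemma starV a : a \is a GRing.unit -> star a^-1 = (star a)^-1.
Proof.
move=> ua; have sVs : star a^-1 * star a = 1 by rewrite -starM mulrV // star1.
have ssV : star a * star a^-1 = 1 by rewrite -starM mulVr // star1.
have us : star a \is a GRing.unit by apply/unitrP; exists (star a^-1).
by apply: (mulrI us); rewrite ssV mulrV.
Qed.

(** The Neumann series, summed as the fixed point of [1 + x * l]; its majorant is
    the geometric series of ratio [cnorm x]. *)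
Lemma unit_one_sub x : cnorm x < 1 -> 1 - x \is a GRing.unit.
Proof.
move=> x1; pose r := cnorm x; have r0 : 0 <= r := cnorm_ge0 x.
have r1 : 0 < 1 - r by rewrite subr_gt0.
pose F a := 1 + x * a; pose zeta k := iter k (fun s : R => 1 + r * s) 0.
have zeta_step k : zeta k.+2 - zeta k.+1 = r * (zeta k.+1 - zeta k).
  by rewrite /zeta /=; ring.
have normF a b : cnorm (F a - F b) <= r * cnorm (a - b).
  by rewrite opprD addrACA subrr add0r -mulrBr ler_cnormM.
have [k | k | a b _ _ | l [ul Fl _]] :=
    @majorized_fixpoint R A F zeta (1 - r)^-1 r (erefl _).
- elim: k => [|k IHk]; first by rewrite /= /F !mulr0 !addr0 !subr0 cnorm1.
  by rewrite zeta_step; apply: le_trans (normF _ _) (ler_wpM2l r0 IHk).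
- elim: k => [|k IHk]; first by rewrite invr_ge0 ltW.
  have := ler_wpM2l r0 IHk; rewrite /= -/(zeta k).
  by have := mulVf (lt0r_neq0 r1); nra.
- exact: normF.
have xl : (1 - x) * l = 1 by rewrite mulrBl mul1r -{1}Fl addrK.
have cxl : GRing.comm x l.
  apply: (cnorm_lim_unique (cnorm_lim_mull x ul)).
  have := cnorm_lim_mulr x ul; congr cnorm_lim; apply/funext.
  suff xu k : GRing.comm x (iter k F 0) by move=> k; rewrite xu.
  elim: k => [|k IHk]; first exact: commr0.
  by apply: commrD; [exact: commr1 | exact: commrM].
by apply/unitrP; exists l; rewrite xl mulrBr mulr1 -cxl -{1}(mul1r l) -mulrBl.
Qed.

(** With [p = a - r] a square, [|t - p| <= t] for some [t]; then
    [a = (t + r) - (t - p)] is a multiple of [1 - x] with [|x| <= t / (t + r) < 1]. *)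
Lemma unit_of_lower_bound a r : 0 < r -> cle (r%:C *: 1) a -> a \is a GRing.unit.
Proof.
move=> r0 /positiveP/hermitian_squareP[_ [t t0 tle]].
have rt : 0 < t + r := ltr_wpDl t0 r0.
have rtC : (t + r)%:C \is a GRing.unit.
  by rewrite unitfE (fmorph_eq0 (real_complex R)) gt_eqF.
pose x := ((t + r)^-1)%:C *: ((t + r)%:C *: 1 - a).
have -> : a = (t + r)%:C *: (1 - x).
  rewrite scalerBr scalerA -rmorphM mulfV ?gt_eqF // scale1r.
  by rewrite subKr.
rewrite scaler_unit //; apply: unit_one_sub.
rewrite cnormZr gtr0_norm ?invr_gt0 // mulrC ltr_pdivrMr // mul1r.
by move: tle; rewrite opprB addrA -scalerDl -rmorphD; lra.
Qed.

(** * Positive two-by-two matrices *)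

(** [(n1, n2)] and [(m1, m2)] are the columns of [N] in [star N * N]. *)
Lemma mxpositive_mx2P p q q' s : mxpositive (mx2 p q q' s) ->
  exists n1 n2 m1 m2,
    [/\ p = star n1 * n1 + star n2 * n2, q = star n1 * m1 + star n2 * m2,
       q' = star m1 * n1 + star m2 * n2 & s = star m1 * m1 + star m2 * m2].
Proof.
case=> N NE; pose i0 : 'I_(1 + 1) := lshift 1 ord0; pose i1 : 'I_(1 + 1) := rshift 1 ord0.
have NNE i j : (mxstar N *m N) i j = star (N i0 i) * N i0 j + star (N i1 i) * N i1 j.
  by rewrite mxE (@big_split_ord _ _ _ 1 1) !big_ord1 /= !mxE.
exists (N i0 i0), (N i1 i0), (N i0 i1), (N i1 i1).
rewrite -!NNE -NE /mx2; split.
- by apply/esym/(etrans (block_mxEul _ _ _ _ _ _)); rewrite mxE eqxx mulr1n.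
- by apply/esym/(etrans (block_mxEur _ _ _ _ _ _)); rewrite mxE eqxx mulr1n.
- by apply/esym/(etrans (block_mxEdl _ _ _ _ _ _)); rewrite mxE eqxx mulr1n.
- by apply/esym/(etrans (block_mxEdr _ _ _ _ _ _)); rewrite mxE eqxx mulr1n.
Qed.

Lemma mxpositive_mx2_hermitian p q q' s : mxpositive (mx2 p q q' s) ->
  [/\ star p = p, star q = q' & star s = s].
Proof.
case/mxpositive_mx2P => [n1 [n2 [m1 [m2 [-> -> -> ->]]]]].
by rewrite !starD !starM !starK.
Qed.

(** The quadratic form at the column [(x, y)] is a sum of two elements
    [star n * n], one for each row of [N]. *)
Lemma mxpositive_mx2_form p q q' s x y : mxpositive (mx2 p q q' s) ->
  positive (star x * p * x + star x * q * y + star y * q' * x + star y * s * y).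
Proof.
case/mxpositive_mx2P => [n1 [n2 [m1 [m2 [-> -> -> ->]]]]].
have sqE n m : star (n * x + m * y) * (n * x + m * y) =
    star x * (star n * n) * x + star x * (star n * m) * y
    + star y * (star m * n) * x + star y * (star m * m) * y.
  by rewrite starD !starM mulrDl !mulrDr !mulrA !addrA.
have -> : forall a1 a2 b1 b2 c1 c2 d1 d2 : A,
    star x * (a1 + a2) * x + star x * (b1 + b2) * y
    + star y * (c1 + c2) * x + star y * (d1 + d2) * y =
    (star x * a1 * x + star x * b1 * y + star y * c1 * x + star y * d1 * y) +
    (star x * a2 * x + star x * b2 * y + star y * c2 * x + star y * d2 * y).
  move=> a1 a2 b1 b2 c1 c2 d1 d2; rewrite !mulrDr !mulrDl.
  by rewrite [RHS]addrACA [X in _ = X + _]addrACA [X in _ = X + _ + _]addrACA.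
by rewrite -!sqE; apply: positiveD; eexists.
Qed.

(** The column [(- p^-1 * q, 1)] minimizes the quadratic form among those with
    second entry 1. *)
Lemma schur_complement_positive p q q' s :
  mxpositive (mx2 p q q' s) -> p \is a GRing.unit -> cle (star q * p^-1 * q) s.
Proof.
move=> pos up; have [sp sq ss] := mxpositive_mx2_hermitian pos.
have := mxpositive_mx2_form (- (p^-1 * q)) 1 pos.
rewrite star1 !mul1r !mulr1 starN starM starV // sp -sq.
rewrite !mulrN !mulNr opprK mulrVK // !mulrA.
by rewrite subrr add0r addrC.
Qed.

(** The quadratic form at [(1, - t)] is [p - 2 t + t^2 s].  When [s <= K], its
    positivity yields [p >= 2 t - t^2 K], which for [t = 1 / K] is the bound
    [p >= t]. *)
Lemma unit_of_mxpositive_offdiag1 p s :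
  mxpositive (mx2 p 1 1 s) -> p \is a GRing.unit.
Proof.
move=> pos; have [_ _ ss] := mxpositive_mx2_hermitian pos.
pose K := cnorm s + 1; have K0 : 0 < K by rewrite ltr_wpDl // cnorm_ge0.
pose t := K^-1; have t0 : 0 < t by rewrite invr_gt0.
have [w [sw wE _]] : exists w, [/\ star w = w, w * w = K%:C *: 1 - s
    & forall v, GRing.comm v s -> GRing.comm v w].
  by apply: sqrt_real_sub => //; rewrite /K lerDl.
apply: (unit_of_lower_bound t0); rewrite /cle.
have -> : p - t%:C *: 1 =
    (star 1 * p * 1 + star 1 * 1 * (- (t%:C *: 1)) + star (- (t%:C *: 1)) * 1 * 1
      + star (- (t%:C *: 1)) * s * (- (t%:C *: 1)))
    + (t * t)%:C *: (w * w).
  rewrite wE starN starZr star1 !mul1r !mulr1 mulrN !mulNr opprK.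
  rewrite -scalerAr -scalerAl mulr1 mul1r scalerA -rmorphM scalerBr scalerA -rmorphM.
  rewrite -(mulrA t t) mulVf ?gt_eqF // mulr1.
  by rewrite addrA addrAC addrK addrAC subrK.
apply: positiveD; first exact: mxpositive_mx2_form.
by apply/positiveP/hermitian_squareZ; [rewrite mulr_ge0 ?ltW | exists w].
Qed.

Lemma inv_ge1 p : strictly_positive p -> cle p 1 -> cle 1 p^-1.
Proof.
case=> pp up p1; have sp := positive_sa pp; rewrite /cle.
(* [p^-1] is written [star p^-1 * p * p^-1] to exhibit it as positive *)
have -> : p^-1 - 1 = (1 - p) + star (1 - p) * (star p^-1 * p * p^-1) * (1 - p).
  rewrite starV // sp mulVr // mul1r starB star1 sp.
  rewrite mulrBl mul1r mulrV // mulrBl mul1r mulrBr mulr1 mulVr //.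
  by rewrite opprB [RHS]addrCA subrKA subrr addr0.
by apply: positiveD => //; apply/positive_congr/positive_congr.
Qed.

End Positive.

Lemma map_mx2 (R : realType) (A B : cstarAlgType R) (f : A -> B) (p q q' s : A) :
  map_mx f (mx2 p q q' s) = mx2 (f p) (f q) (f q') (f s).
Proof.
have map1 c : map_mx f (c%:M : 'M[A]_1) = (f c)%:M.
  by apply/matrixP => i j; rewrite !mxE !ord1 eqxx !mulr1n.
by apply: etrans (@map_block_mx _ _ f 1 1 1 1 _ _ _ _) _; rewrite !map1.
Qed.

(** [N] has first row [(a, b)] and second row zero. *)
Lemma mxpositive_gram2 (R : realType) (A : cstarAlgType R) (a b : A) :
  mxpositive (mx2 (star a * a) (star a * b) (star (star a * b)) (star b * b)).
Proof.
exists (mx2 a b 0 0); rewrite /mxstar map_mx2 !star0 starM starK.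
have -> : (mx2 (star a) (star b) 0 0)^T = mx2 (star a) 0 (star b) 0.
  by apply: etrans (@tr_block_mx _ 1 1 1 1 _ _ _ _) _; rewrite !tr_scalar_mx.
apply/esym/(etrans (@mulmx_block _ 1 1 1 1 1 1 _ _ _ _ _ _ _ _)).
by rewrite -!scalar_mxM !mul0r -!raddfD !addr0.
Qed.

(** * Maps satisfying the Cauchy-Schwarz inequality *)

Section CauchySchwarz.
Variables (R : realType) (A B : cstarAlgType R) (Phi : A -> B).

(** The image of the Gram matrix has [Phi (star (star a * b))] as its lower left
    entry; that this is [star (Phi (star a * b))] follows from the positivity of
    the image, which is in particular self-adjoint. *)
Lemma two_positive_cauchy_schwarz : n_positive 2 Phi -> lieb_cauchy_schwarz Phi.
Proof.
move=> Phi2 a b; have := Phi2 _ (mxpositive_gram2 a b).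
rewrite map_mx2 => pos.
by have [_ -> _] := mxpositive_mx2_hermitian pos.
Qed.

Hypothesis PhiCS : lieb_cauchy_schwarz Phi.

Lemma kadison_of_cauchy_schwarz a : Phi 1 \is a GRing.unit ->
  cle (star (Phi a) * (Phi 1)^-1 * Phi a) (Phi (star a * a)).
Proof.
move=> u1; have := PhiCS 1 a; rewrite star1 !mul1r => pos.
exact: schur_complement_positive pos u1.
Qed.

(** For [a = star b * b], Cauchy-Schwarz at [b] and [b * a^-1] avoids square
    roots: [star b * (b * a^-1) = 1] and
    [star (b * a^-1) * (b * a^-1) = a^-1]. *)
Lemma choi_of_cauchy_schwarz a : Phi 1 = 1 -> strictly_positive a ->
  Phi a \is a GRing.unit /\ cle (Phi a)^-1 (Phi a^-1).
Proof.
move=> Phi1 [[b bE] ua].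
have sa : star a = a by rewrite bE starM starK.
have := PhiCS b (b * a^-1); rewrite starM starV // sa !mulrA -bE.
rewrite -(mulrA _ (star b)) -bE mulrV // mulVr // mul1r Phi1 star1 => pos.
have uPa := unit_of_mxpositive_offdiag1 pos; split=> //.
by have := schur_complement_positive pos uPa; rewrite star1 mul1r mulr1.
Qed.

End CauchySchwarz.

Theorem corollary2p6 (R : realType) (A B : cstarAlgType R) (Phi : A -> B) :
  lieb_map Phi \/ n_positive 2 Phi ->
  strictly_positive (Phi 1) ->
  ((forall a : A, cle (star (Phi a) * (Phi 1)^-1 * Phi a) (Phi (cabs a ^+ 2))) /\
   (cle (Phi 1) 1 ->
      forall a : A, cle (cabs (Phi a) ^+ 2) (Phi (cabs a ^+ 2)))) /\
  (Phi 1 = 1 ->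
     forall a : A, strictly_positive a ->
       Phi a \is a GRing.unit /\ cle (Phi a)^-1 (Phi a^-1)).
Proof.
move=> PhiLP pos1.
have PhiCS : lieb_cauchy_schwarz Phi.
  by case: PhiLP => [[] | /two_positive_cauchy_schwarz].
have kadison a := kadison_of_cauchy_schwarz PhiCS a pos1.2.
split; last by move=> Phi1 a; apply: choi_of_cauchy_schwarz.
split=> [a | le1 a]; rewrite !cabs_sqr //.
(* insert the lower bound of [kadison] between the two sides *)
rewrite /cle -(subrKA (star (Phi a) * (Phi 1)^-1 * Phi a)).
apply: positiveD; first exact: kadison.
have := positive_congr (Phi a) (inv_ge1 pos1 le1).
by rewrite mulrBr mulrBl mulr1.
Qed.
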